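(* Let $\Sigma_{\mathbf A}$ be an aperiodic and irreducible subshift of finite type with left shift $\sigma$. Let $(s_n)_{n\ge0}$ be a monotone decreasing sequence of positive reals such that, with $S_n:=\sum_{k=0}^{n-1}s_k$, one has $\lim_{n\to\infty}S_n=\infty$ and $\limsup_{n\to\infty}\frac{S_n}{ns_n}=\infty$. Then for every continuous potential $\phi\colon\Sigma_{\mathbf A}\to\mathbb{R}$ we have $E_\phi^s(\alpha)=\emptyset$ for all $\alpha\in\mathbb{R}\setminus L(\phi)$, and for every $\alpha\in L(\phi)$, $$\dim_{\rm P}E_\phi^s(\alpha)=h_{\rm top}(\Sigma_{\mathbf A}).$$
   Context: Let $\mathcal A=\{1,\dots,K\}$ be a finite alphabet, $\Sigma=\mathcal A^{\mathbb N}$ with $\mathbb N=\{0,1,2,\dots\}$, $\sigma$ the left shift, and $d(\mathbf i,\mathbf j)=e^{-\min\{n\ge0:\,i_n\ne j_n\}}$ the metric on $\Sigma$. For a $K\times K$ matrix $\mathbf A$ with entries in $\{0,1\}$, the subshift of finite type is $\Sigma_{\mathbf A}=\{\mathbf i=(i_0,i_1,\dots)\in\Sigma:\mathbf A_{i_k,i_{k+1}}=1\ \text{for all }k\ge0\}$. It is aperiodic and irreducible if there is $r\ge1$ such that every entry of $\mathbf A^r$ is strictly positive. Put $$L(\phi)=\Big\{\alpha\in\mathbb{R}:\exists\,\mathbf i\in\Sigma_{\mathbf A}\text{ with }\lim_{n\to\infty}\frac1n\sum_{k=0}^{n-1}\phi(\sigma^k\mathbf i)=\alpha\Big\},\qquad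 E_\phi^s(\alpha)=\Big\{\mathbf i\in\Sigma_{\mathbf A}:\lim_{n\to\infty}\frac1{S_n}\sum_{k=0}^{n-1}s_k\phi(\sigma^k\mathbf i)=\alpha\Big\}.$$ $\dim_{\rm P}$ denotes the packing (Tricot) dimension with respect to $d$, and $h_{\rm top}(\Sigma_{\mathbf A})$ the topological entropy of $(\Sigma_{\mathbf A},\sigma)$. *)

(* Defs.v *)
From HB Require Import structures.
From mathcomp Require Import all_boot all_order all_algebra finmap.
From mathcomp Require Import all_classical all_reals all_analysis.

Set Implicit Arguments.
Unset Strict Implicit.
Unset Printing Implicit Defensive.

Import Order.TTheory GRing.Theory Num.Theory.
Import numFieldNormedType.Exports.

Local Open Scope classical_set_scope.
Local Open Scope ring_scope.

(** * Packing dimension of a subset of a metric space *)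

Section packing.
Context {R : realType} {T : metricType R}.
Implicit Types (E : set T) (s delta : R).

Definition cball (x : T) (r : R) : set T := [set y | mdist x y <= r].

(* A ball is recorded as the pair of its center and radius. *)
Definition is_packing E delta (B : set (T * R)) :=
  [/\ countable B,
      forall b, B b -> E b.1 /\ 0 < b.2 <= delta &
      trivIset B (fun b => cball b.1 b.2)].

Definition packing_content s delta E : \bar R :=
  ereal_sup [set \esum_(b in B) ((2 * b.2) `^ s)%:E | B in is_packing E delta].

(* The content is nondecreasing in [delta], so its limit as [delta] tends to
   [0+] is this infimum. *)
Definition packing_premeasure s E : \bar R :=
  ereal_inf [set packing_content s delta E | delta in [set delta | 0 < delta]].

Definition packing_measure s E : \bar R :=
  ereal_inf [set (\sum_(0 <= i <oo) packing_premeasure s (F i))%E |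
    F in [set F : (set T)^nat | E `<=` \bigcup_i F i]].

Definition packing_dim E : \bar R :=
  ereal_inf [set s%:E | s in [set s | 0 <= s /\ packing_measure s E = 0%E]].

End packing.

(** * Topological entropy (Bowen's definition by separated sets) *)

Section entropy.
Context {R : realType} {T : metricType R}.
Implicit Types (f : T -> T) (Y : set T) (n : nat) (e : R).

Definition dyn_separated f n e (F : {fset T}) :=
  forall x y, x \in F -> y \in F -> x <> y ->
    exists2 k, (k < n)%N & e < mdist (iter k f x) (iter k f y).

Definition max_separated f Y n e : \bar R :=
  ereal_sup [set (#|` F|%:R)%:E | F in
    [set F : {fset T} | [set` F] `<=` Y /\ dyn_separated f n e F]].

(* The growth rate is nonincreasing in [e], so its limit as [e] tends to
   [0+] is this supremum. *)
Definition top_entropy f Y : \bar R :=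
  ereal_sup [set limn_esup (fun n => n%:R^-1%:E * lne (max_separated f Y n e))%E |
    e in [set e | 0 < e]].

End entropy.

(** * The full shift *)

(* Sequences over the alphabet ['I_K], i.e. {0, ..., K-1}; the parameter [R] is
   there to carry the [R]-valued metric. *)
Definition fullshift (R : realType) (K : nat) : Type := nat -> 'I_K.

Section fullshift_metric.
Context {R : realType} {K : nat}.
Implicit Types i j k : fullshift R K.

HB.instance Definition _ := Choice.on (fullshift R K).

Definition shift_dist i j : R :=
  if pselect (exists n, i n != j n) is left ij then expR (- (ex_minn ij)%:R)
  else 0.

Let shift_distxx i : shift_dist i i = 0.
Proof.
by rewrite /shift_dist; case: pselect => // ii; exfalso; case: ii => n; rewrite eqxx.
Qed.

Let shift_dist_ge0 i j : 0 <= shift_dist i j.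
Proof. by rewrite /shift_dist; case: pselect => // ?; exact: expR_ge0. Qed.

Let shift_dist_positivity i j : shift_dist i j = 0 -> i = j.
Proof.
rewrite /shift_dist; case: pselect => [ij /eqP|nij _]; first by rewrite expR_eq0.
by apply/funext => n; apply/eqP/negPn/negP => ij; apply: nij; exists n.
Qed.

Let shift_dist_sym i j : shift_dist i j = shift_dist j i.
Proof.
rewrite /shift_dist; case: pselect => [ij|nij].
  case: pselect => [ji|nji].
    by congr (expR (- _%:R)); apply: eq_ex_minn => n; rewrite eq_sym.
  by case: nji; case: ij => n; rewrite eq_sym => ?; exists n.
case: pselect => // ji; case: nij; case: ji => n; rewrite eq_sym => ?; by exists n.
Qed.

Let expR_le_shift_dist i j n : i n != j n -> expR (- n%:R) <= shift_dist i j.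
Proof.
move=> ijn; rewrite /shift_dist; case: pselect => [ij|]; last by case; exists n.
by case: ex_minnP => m _ /(_ _ ijn) mn; rewrite ler_expR lerN2 ler_nat.
Qed.

Let shift_dist_triangle j i k :
  shift_dist i k <= shift_dist i j + shift_dist j k.
Proof.
rewrite {1}/shift_dist; case: pselect => [ik|_]; last exact: addr_ge0.
case: ex_minnP => n ikn _; have [ijn|] := eqVneq (i n) (j n).
  by rewrite ler_wpDl// expR_le_shift_dist// -ijn.
by move=> /expR_le_shift_dist ijn; rewrite ler_wpDr.
Qed.

HB.instance Definition _ := isMetric.Build R (fullshift R K) shift_distxx
  shift_dist_positivity shift_dist_sym shift_dist_triangle.

Lemma mdist_shiftE i j : mdist i j = shift_dist i j. Proof. by []. Qed.

Definition left_shift i : fullshift R K := fun n => i n.+1.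

End fullshift_metric.

(** * Subshifts of finite type and (weighted) Birkhoff averages *)

Definition sft (R : realType) (K : nat) (A : 'M[nat]_K) : set (fullshift R K) :=
  [set i | forall k, A (i k) (i k.+1) = 1%N].
Arguments sft R {K} A.

Definition aperiodic_irreducible (K : nat) (A : 'M[nat]_K) :=
  exists2 r, (1 <= r)%N & forall a b, (0 < (A ^+ r) a b)%N.

Section averages.
Context {R : realType} {K : nat}.
Implicit Types (A : 'M[nat]_K) (phi : fullshift R K -> R) (s : R^nat).

Definition birkhoff_spectrum A phi : set R :=
  [set alpha | exists2 i, sft R A i &
    (fun n => n%:R^-1 * \sum_(0 <= k < n) phi (iter k left_shift i)) @ \oo --> alpha].

Definition weighted_level_set A s phi (alpha : R) : set (fullshift R K) :=
  [set i | sft R A i /\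
    (fun n => (series s n)^-1 * \sum_(0 <= k < n) s k * phi (iter k left_shift i))
      @ \oo --> alpha].

End averages.

(* Main.v *)
Require Import Defs.
From HB Require Import structures.
From mathcomp Require Import all_boot all_order all_algebra.
From mathcomp Require Import finmap zify ring lra.
From mathcomp Require Import all_classical all_reals all_analysis.

Set Implicit Arguments.
Unset Strict Implicit.
Unset Printing Implicit Defensive.

Import Order.TTheory GRing.Theory Num.Theory.
Import numFieldNormedType.Exports.

Local Open Scope classical_set_scope.
Local Open Scope ring_scope.

(** Both parts rest on gluing: by primitivity any sequence of orbit pieces can be
    followed, in order, by a single point of the subshift, at the cost of [r]
    steps of transition between two pieces ([specification]).

    A limit of weighted averages is also a limit of Birkhoff averages. The weights
    decrease and their sum diverges, so by summation by parts ([abel_lower_bound])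
    the weighted averages of a sequence cannot converge to [alpha] if the averages
    over all its blocks of some length [n] are below [alpha] by a fixed margin, or
    all above. Sliding a block by one step changes its sum by a bounded amount,
    hence for each [n] some block of length [n] of the orbit has a sum within a
    constant of [alpha * n%:R] ([balanced_block]). Gluing such blocks of growing length yields a point with
    Birkhoff average [alpha] ([balanced_blocks_spectrum]).

    The upper bound on the dimension holds for every subset of the subshift: at
    scale [expR (- n%:R)] a packing has at most as many balls as there are words
    of length [n] ([packing_measure_eq0]).

    For the lower bound, start from a point [x] with Birkhoff average [alpha],
    which by summation by parts is also its weighted average. If [n * s n] is
    negligible with respect to the sum [series s n] of the first [n] weights, then
    so is the total weight of a window from [n] to [C * n], for a fixed [C]. There
    are infinitely many such [n], and one can let [C] grow. Modifying [x]
    arbitrarily on a sparse sequence of such windows does not change its weighted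
    average ([window_weighted_average]), so the whole subshift can be copied into
    the windows ([insert_windows]). At the end of a window the free coordinates
    are almost all the coordinates seen so far, so that at these scales the level
    set looks like the whole subshift. As the packing dimension is governed by
    the best scales, this gives the full dimension; that a countable cover does
    not lower it is a Baire category argument ([packing_premeasure_window]). *)

(** * Cylinders and gluing of orbits *)

Section gluing.
Context {R : realType} {K : nat}.
Implicit Types (x y z : fullshift R K) (n p : nat).

Definition agree n x y := forall j, (j < n)%N -> x j = y j.

Lemma agree_sym n x y : agree n x y -> agree n y x.
Proof. by move=> xy j /xy. Qed.

Lemma agree_trans n x y z : agree n x y -> agree n y z -> agree n x z.
Proof. by move=> xy yz j jn; rewrite xy// yz. Qed.

Lemma agree_le m n x y : (m <= n)%N -> agree n x y -> agree m x y.
Proof. by move=> mn xy j jm; apply: xy; exact: leq_trans jm mn. Qed.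

Lemma agreeS n x y : agree n x y -> x n = y n -> agree n.+1 x y.
Proof. by move=> xy xyn j; rewrite ltnS leq_eqVlt => /predU1P[->|/xy]. Qed.

Lemma mdist_agree n x y : mdist x y <= expR (- n%:R) <-> agree n x y.
Proof.
rewrite mdist_shiftE /shift_dist; case: pselect => [ij|nij]; last first.
  split=> [_ j _|_]; last exact: expR_ge0.
  by apply/eqP/negPn/negP => xyj; apply: nij; exists j.
case: ex_minnP => m xym mmin; rewrite ler_expR lerN2 ler_nat; split => [nm j jn|xy].
  apply/eqP/negPn/negP => /mmin; rewrite leqNgt => /negP; apply.
  exact: leq_trans jn nm.
by rewrite leqNgt; apply/negP => /xy xym'; rewrite xym' eqxx in xym.
Qed.

Lemma mdist_ge_expR n x y : x n != y n -> expR (- n%:R) <= mdist x y.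
Proof.
move=> xyn; rewrite mdist_shiftE /shift_dist.
case: pselect => [ij|nij]; last by case: nij; exists n.
by case: ex_minnP => m _ /(_ _ xyn) mn; rewrite ler_expR lerN2 ler_nat.
Qed.

Lemma expRN_le_exists (e : R) : 0 < e -> exists n, expR (- n%:R) <= e.
Proof.
move=> e0; exists (Num.truncn e^-1).+1.
rewrite expRN invf_ple ?posrE ?expR_gt0//; apply: le_trans (expR_ge1Dx _).
by apply: le_trans (ltW (truncnS_gt _)) _; rewrite lerDr.
Qed.

Lemma iter_shiftE k x j : iter k (@left_shift R K) x j = x (k + j)%N.
Proof.
by elim: k j => //= k IH j; rewrite /left_shift IH addnS.
Qed.

Variable A : 'M[nat]_K.

Lemma sft_iter_shift k x : sft R A x -> sft R A (iter k left_shift x).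
Proof. by move=> xA j; rewrite !iter_shiftE addnS; exact: xA. Qed.

(** Compactness of the subshift, as the choice of a point in a nested sequence of
    cylinders. *)
Lemma nested_cylinders (x_ : nat -> fullshift R K) (p_ : nat -> nat) :
  (forall k, sft R A (x_ k)) -> (forall k, (p_ k < p_ k.+1)%N) ->
  (forall k, agree (p_ k) (x_ k) (x_ k.+1)) ->
  exists2 x, sft R A x & forall k, agree (p_ k) (x_ k) x.
Proof.
move=> xA pS xS.
have le_p k l : (k <= l)%N -> (p_ k <= p_ l)%N.
  by apply: (homo_leq (@leqnn) leq_trans) => ?; exact: ltnW.
have le_id k : (k <= p_ k)%N by elim: k => // k IH; exact: leq_ltn_trans IH (pS k).
have xD k l : agree (p_ k) (x_ k) (x_ (k + l)%N).
  elim: l => [|l IH]; first by rewrite addn0.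
  rewrite addnS; apply: (agree_trans IH).
  by apply: (agree_le _ (xS _)); apply: le_p; rewrite leq_addr.
have xle k l : (k <= l)%N -> agree (p_ k) (x_ k) (x_ l).
  by move=> kl; rewrite -(subnKC kl).
pose x : fullshift R K := fun j => x_ j.+1 j.
have xx k : agree (p_ k) (x_ k) x.
  move=> j jp; rewrite /x; have [kj|jk] := leqP k j.+1; first exact: xle.
  by apply/esym/(xle _ _ (ltnW jk)); exact: le_id.
exists x => // k; rewrite -(xx k.+2 k) -?(xx k.+2 k.+1); first exact: xA.
  exact: le_id.
by have := le_id k.+2; apply: leq_trans.
Qed.

Lemma mxpow_path r (a b : 'I_K) :
  (forall a b, A a b = 0%N \/ A a b = 1%N) ->
  (0 < (A ^+ r) a b)%N ->
  exists f : nat -> 'I_K,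
    [/\ f 0%N = a, f r = b & forall j, (j < r)%N -> A (f j) (f j.+1) = 1%N].
Proof.
move=> A01; elim: r a => [|r IH] a.
  rewrite expr0 mxE; case: eqP => // <- _; exists (fun=> a); by split.
rewrite exprS mxE lt0n sum_nat_eq0 negb_forall => /existsP[c].
rewrite /= muln_eq0 negb_or -!lt0n => /andP[Aac].
move=> /IH[f [f0 fr fA]]; exists (fun j => if j is j'.+1 then f j' else a).
split=> // -[_|j /fA//].
by rewrite f0; case: (A01 a c) Aac => ->.
Qed.

(** Primitivity lets one pass from any point of the subshift to any other one
    within exactly [r] steps. *)
Definition gluing_time r := (0 < r)%N /\
  forall (x y : fullshift R K) p, sft R A x -> sft R A y ->
  exists2 w, sft R A w & agree p.+1 x w /\ iter (p + r) left_shift w = y.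

Lemma primitive_gluing :
  (forall a b, A a b = 0%N \/ A a b = 1%N) -> aperiodic_irreducible A ->
  exists r, gluing_time r.
Proof.
move=> A01 [r r0 Ar]; exists r; split=> // x y p xA yA.
have [f [f0 fr fA]] := mxpow_path A01 (Ar (x p) (y 0%N)).
pose w : fullshift R K := fun j => if (j <= p)%N then x j else
  if (j <= p + r)%N then f (j - p)%N else y (j - (p + r))%N.
exists w.
  move=> k; rewrite /w; have [kp|] := ltnP k p.
    by rewrite ltnW//; exact: xA.
  rewrite leq_eqVlt => /predU1P[<-|pk].
    rewrite leqnn -addn1 leq_add2l r0 addKn -f0.
    exact: fA.
  rewrite leqNgt pk/=.
  rewrite ltnNge in pk; have [kpr|] := ltnP k (p + r)%N.
    rewrite (ltnW kpr) subSn; last by lia.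
    by apply: fA; lia.
  rewrite leq_eqVlt => /predU1P[<-|prk].
    rewrite leqnn subSn// subnn addKn fr; exact: (yA 0%N).
  by rewrite leqNgt prk/= (subSn (ltnW prk)); exact: yA.
split=> [j|]; first by rewrite /w ltnS => ->.
apply/funext => j; rewrite iter_shiftE /w.
have -> : (p + r + j <= p)%N = false by apply/negbTE; lia.
case: j => [|j]; first by rewrite addn0 leqnn addKn.
have -> : (p + r + j.+1 <= p + r)%N = false by apply/negbTE; lia.
by rewrite addKn.
Qed.

(** Infinitely many orbit pieces can be glued: the piece [x_ k] is followed from
    time [a_ k] on, except for the last steps before time [a_ k.+1]. *)
Lemma specification r (x_ : nat -> fullshift R K) (a_ : nat -> nat) :
  gluing_time r ->
  (forall k, sft R A (x_ k)) -> a_ 0%N = 0%N ->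
  (forall k, (a_ k + r <= a_ k.+1)%N) ->
  exists2 y, sft R A y &
    forall k j, (a_ k + j + r <= a_ k.+1)%N -> y (a_ k + j)%N = x_ k j.
Proof.
move=> [r0 glue] xA a0 aS.
(* Carrying the orbit of [y] at time [a_ k] along the recursion lets the next
   splice be made without any knowledge of the earlier pieces. *)
pose T k := {y | sft R A y /\ iter (a_ k) left_shift y = x_ k}.
have step k (y : T k) : {y' : T k.+1 | agree (a_ k.+1 - r).+1 (sval y) (sval y')}.
  case: y => y [yA yx] /=; apply: cid.
  have [w wA [yw wx]] := glue y (x_ k.+1) (a_ k.+1 - r)%N yA (xA _).
  rewrite subnK in wx; last by apply: leq_trans (aS k); rewrite leq_addl.
  by exists (exist _ w (conj wA wx)).
have y0 : T 0%N by exists (x_ 0%N); split=> //; rewrite a0.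
pose y_ := fix y_ k : T k := if k is k'.+1 then sval (step k' (y_ k')) else y0.
have y_S k : agree (a_ k.+1 - r).+1 (sval (y_ k)) (sval (y_ k.+1)).
  exact: (svalP (step k (y_ k))).
have [|k|//|y yA yy] := nested_cylinders (x_ := fun k => sval (y_ k))
    (p_ := fun k => (a_ k.+1 - r).+1).
- by move=> k; case: (svalP (y_ k)).
- by have := aS k; have := aS k.+1; lia.
exists y => // k j kj; rewrite -(yy k); last by lia.
have [_ /(congr1 (fun x => x j)) <-] := svalP (y_ k).
by rewrite iter_shiftE.
Qed.

End gluing.

(** * Uniform continuity of the potential *)

Section compactness.
Context {R : realType} {K : nat} (A : 'M[nat]_K).
Implicit Types (x y : fullshift R K) (phi : fullshift R K -> R).

(** If a property of cylinders failed at the root and passed to a parent from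
    its children, then its failure could be followed downwards along a nested
    sequence of cylinders, up to a point around which it fails at all scales. *)
Lemma cylinder_compactness (Q : nat -> fullshift R K -> Prop) :
  (forall x, sft R A x ->
     exists n, forall y, sft R A y -> agree n x y -> Q n y) ->
  (forall n x, sft R A x ->
     (forall y, sft R A y -> agree n x y -> Q n.+1 y) -> Q n x) ->
  forall x, sft R A x -> Q 0%N x.
Proof.
move=> Qloc Qup x xA; apply: contrapT => NQx.
pose T n := {y | sft R A y /\ ~ Q n y}.
have step n (y : T n) : {y' : T n.+1 | agree n (sval y) (sval y')}.
  case: y => y [yA NQy] /=; apply: cid; apply: contrapT => noy'.
  apply: NQy; apply: Qup => // z zA yz; apply: contrapT => NQz.
  by apply: noy'; exists (exist _ z (conj zA NQz)).
pose y_ := fix y_ n : T n :=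
  if n is n'.+1 then sval (step n' (y_ n')) else exist _ x (conj xA NQx).
have [||n|z zA yz] := @nested_cylinders _ _ A (fun n => sval (y_ n)) id.
- by move=> n; case: (svalP (y_ n)).
- by [].
- exact: (svalP (step n (y_ n))).
have [n Qn] := Qloc z zA; have [yA] := svalP (y_ n); apply.
by apply: Qn => //; apply/agree_sym/yz.
Qed.

(** Bounded oscillation and boundedness are local properties, and they pass from
    the [K] children of a cylinder to the cylinder itself. *)
Lemma continuous_uniform phi : {within sft R A, continuous phi} ->
  forall e : R, 0 < e -> exists (m : nat) (C : R), forall x y, sft R A x -> sft R A y ->
    `|phi x| <= C /\ (agree m x y -> `|phi x - phi y| <= e).
Proof.
move=> /subspace_continuousP phi_c e e0.
have [[x0 x0A]|noA] := pselect (exists x, sft R A x); last first.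
  by exists 0%N, 0 => x y xA; case: noA; exists x.
pose Q n z := exists m C, forall x y, sft R A x -> sft R A y ->
  agree n z x -> agree n z y ->
  `|phi x| <= C /\ (agree m x y -> `|phi x - phi y| <= e).
suff [m [C mC]] : Q 0%N x0 by exists m, C => x y xA yA; exact: mC.
apply: cylinder_compactness x0A => [z zA|n z zA Qy].
  have /cvgrPdist_le /(_ (e / 2)) := phi_c z zA.
  rewrite divr_gt0// => /(_ isT).
  rewrite near_withinE /= => /nbhs_ballP[d /= d0 zd].
  have [n nd] : exists n, expR (- n%:R) < d.
    have [|n nd] := @expRN_le_exists R (d / 2); first by rewrite divr_gt0.
    by exists n; rewrite (le_lt_trans nd)// ltr_pdivrMr// ltr_pMr// ltr1n.
  have near_z y : sft R A y -> agree n z y -> `|phi z - phi y| <= e / 2.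
    move=> yA /mdist_agree zy; apply: zd => //.
    by rewrite ballEmdist /=; exact: le_lt_trans nd.
  exists n => y yA zy; exists n, (`|phi z| + e / 2) => u v uA vA yu yv.
  have := near_z u uA (agree_trans zy yu); have := near_z v vA (agree_trans zy yv).
  move=> zv zu; split.
    rewrite -(subrK (phi z) (phi u)) (le_trans (ler_normD _ _))// addrC lerD2l.
    by rewrite distrC.
  move=> _; rewrite (le_trans (ler_distD (phi z) _ _))// (splitr e) lerD//.
  by rewrite distrC.
have /choice[mC HmC] : forall a : 'I_K, exists mC : nat * R,
    forall x y, sft R A x -> sft R A y ->
    agree n z x -> agree n z y -> x n = a -> y n = a ->
    `|phi x| <= mC.2 /\ (agree mC.1 x y -> `|phi x - phi y| <= e).
  move=> a.
  have [[y [yA zy yn]]|noy] :=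
    pselect (exists y, [/\ sft R A y, agree n z y & y n = a]).
    have [m [C mC]] := Qy y yA zy; exists (m, C) => u v uA vA zu zv un vn.
    apply: mC => //; apply: agreeS; rewrite ?un ?vn//.
      exact: agree_trans (agree_sym zy) zu.
    exact: agree_trans (agree_sym zy) zv.
  exists (0%N, 0) => u v uA vA zu zv un; case: noy.
  by exists u.
exists (maxn n.+1 (\max_a (mC a).1)), (\sum_a `|(mC a).2|) => x y xA yA zx zy.
split=> [|xy].
  have [/le_trans + _] := HmC (x n) x x xA xA zx zx erefl erefl; apply.
  rewrite (bigD1 (x n))//= (le_trans (ler_norm _))// lerDl sumr_ge0//.
have [_] := HmC (x n) x y xA yA zx zy erefl (esym (xy n (leq_maxl _ _))).
apply; apply: agree_le xy; rewrite leq_max; apply/orP; right.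
exact: leq_bigmax (fun a => (mC a).1) (x n).
Qed.

End compactness.

(** * Weighted sums with decreasing weights *)

Section weighted_sums.
Context {R : realType}.
Implicit Types (s a b S T : R^nat) (alpha C e : R).

(** Summation by parts: decreasing weights cannot amplify the negative part of
    the partial sums. *)
Lemma abel_lower_bound s b C : nonincreasing_seq s -> (forall n, 0 <= s n) ->
  (forall n, - C <= \sum_(0 <= k < n) b k) ->
  forall n, - (C * s 0%N) <= \sum_(0 <= k < n) s k * b k.
Proof.
move=> s_dec s_ge0 bC n.
have C0 : 0 <= C by have := bC 0%N; rewrite big_geq// oppr_le0.
(* The induction needs the slack [s m * (B + C)], which decreases with [m]. *)
suff key m : s m * (\sum_(0 <= k < m.+1) b k + C) - C * s 0%N <=
    \sum_(0 <= k < m.+1) s k * b k.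
  case: n => [|n]; first by rewrite big_geq// oppr_le0 mulr_ge0.
  apply: le_trans (key n); rewrite -[leLHS]add0r lerD2r mulr_ge0//.
  by rewrite -lerBlDr sub0r.
elim: m => [|m IH]; first by rewrite !big_nat1; lra.
rewrite [in leRHS]big_nat_recr//= [in leLHS]big_nat_recr//=.
have sS : s m.+1 <= s m by exact: s_dec.
have := bC m.+1; set B := \sum_(0 <= k < m.+1) b k in IH *.
move=> CB; have : 0 <= (s m - s m.+1) * (B + C).
  by rewrite mulr_ge0 ?subr_ge0// -lerBlDr sub0r.
lra.
Qed.

Lemma eventually_ge0_lbound (B : R^nat) : (\forall n \near \oo, 0 <= B n) ->
  exists C, forall n, - C <= B n.
Proof.
move=> [N _ BN]; exists (\sum_(0 <= n < N) `|B n|) => n.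
have [Nn|nN] := leqP N n.
  by apply: le_trans (BN n Nn); rewrite oppr_le0 sumr_ge0.
rewrite lerNl; apply: le_trans (ler_norm _) _; rewrite normrN.
by rewrite (big_rem n) ?mem_index_iota//= lerDl sumr_ge0.
Qed.

Lemma average_cvgP S T alpha : (forall n, (0 < n)%N -> 0 < S n) ->
  (fun n => (S n)^-1 * T n) @ \oo --> alpha <->
  forall e, 0 < e -> \forall n \near \oo, `|T n - alpha * S n| <= e * S n.
Proof.
move=> S0.
have E n e : (0 < n)%N ->
    (`|alpha - (S n)^-1 * T n| <= e) = (`|T n - alpha * S n| <= e * S n).
  move=> /S0 Sn; rewrite distrC.
  have -> : (S n)^-1 * T n - alpha = (T n - alpha * S n) / S n.
    by field; rewrite gt_eqF.
  by rewrite normrM normfV (gtr0_norm Sn) ler_pdivrMr.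
split=> [/cvgrPdist_le cv e e0|cv].
  have := cv e e0; apply: filterS2 (nbhs_infty_gt 0) => n n0.
  by rewrite E.
apply/cvgrPdist_le => e e0.
by have := cv e e0; apply: filterS2 (nbhs_infty_gt 0) => n n0; rewrite E.
Qed.

Lemma cvgy_absorb S C e : S @ \oo --> +oo -> 0 < e ->
  \forall n \near \oo, C <= e * S n.
Proof.
move=> /cvgryPge /(_ (C / e)) + e0; apply: filterS => n.
by rewrite ler_pdivrMr// mulrC.
Qed.

Lemma series_gt0 s : (forall n, 0 < s n) -> forall n, (0 < n)%N -> 0 < series s n.
Proof.
move=> s0 [//|n] _; rewrite /series/= big_nat_recr//=.
by rewrite ltr_wpDl// sumr_ge0// => *; exact: ltW.
Qed.

(** Regularity of Riesz means with decreasing weights: if the averages of [a] tend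
    to [alpha], the partial sums of [e / 2 + (a k - alpha)] and of
    [e / 2 - (a k - alpha)] are bounded below. *)
Lemma weighted_average_cvg s a alpha : nonincreasing_seq s ->
  (forall n, 0 < s n) -> series s @ \oo --> +oo ->
  (fun n => n%:R^-1 * \sum_(0 <= k < n) a k) @ \oo --> alpha ->
  (fun n => (series s n)^-1 * \sum_(0 <= k < n) s k * a k) @ \oo --> alpha.
Proof.
move=> s_dec s0 Sy.
move=> /(average_cvgP (fun n => \sum_(0 <= k < n) a k) alpha) cva.
have {}cva := cva (fun n n0 => etrans (ltr0n R n) n0).
apply/average_cvgP; first exact: series_gt0.
move=> e e0; have e20 : 0 < e / 2 by rewrite divr_gt0.
have lower c : (\forall n \near \oo,
      0 <= \sum_(0 <= k < n) (e / 2 + c * (a k - alpha))) ->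
    \forall n \near \oo,
      - (e * series s n) <= c * (\sum_(0 <= k < n) s k * a k - alpha * series s n).
  move=> /eventually_ge0_lbound[C Cb].
  have := cvgy_absorb (C * s 0%N) Sy e20; apply: filterS => n Cn.
  have := abel_lower_bound s_dec (fun n => ltW (s0 n)) Cb n.
  have -> : \sum_(0 <= k < n) s k * (e / 2 + c * (a k - alpha)) =
      e / 2 * series s n + c * (\sum_(0 <= k < n) s k * a k - alpha * series s n).
    rewrite /series /= !mulr_sumr -sumrB !mulr_sumr -big_split/=.
    by apply: eq_bigr => k _; ring.
  lra.
have sumE c n : \sum_(0 <= k < n) (e / 2 + c * (a k - alpha)) =
    e / 2 * n%:R + c * (\sum_(0 <= k < n) a k - alpha * n%:R).
  rewrite big_split/= sumr_const_nat subn0 -mulr_sumr sumrB sumr_const_nat subn0.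
  by rewrite !mulr_natr.
have := cva _ e20 => cve.
have up : \forall n \near \oo, - (e * series s n) <=
    1 * (\sum_(0 <= k < n) s k * a k - alpha * series s n).
  apply: lower; apply: filterS cve => n; rewrite sumE ler_norml; lra.
have dn : \forall n \near \oo, - (e * series s n) <=
    -1 * (\sum_(0 <= k < n) s k * a k - alpha * series s n).
  apply: lower; apply: filterS cve => n; rewrite sumE ler_norml; lra.
by apply: filterS2 up dn => n; rewrite ler_norml; lra.
Qed.

Lemma sum_window s i j n : nonincreasing_seq s -> (forall n, 0 <= s n) ->
  \sum_(0 <= k < n) s k * (i <= k < j)%:R <= (j - i)%:R * s i.
Proof.
move=> s_dec s_ge0; elim: n => [|n IH].
  by rewrite big_geq// mulr_ge0.
have [nj|jn] := ltnP n j; last first.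
  rewrite big_nat_recr//= andbC ltnNge jn/= mulr0 addr0; exact: IH.
suff: \sum_(0 <= k < n.+1) s k * (i <= k < j)%:R <= (n.+1 - i)%:R * s i.
  move/le_trans; apply; rewrite ler_wpM2r// ler_nat leq_sub2r//.
elim: n nj {IH} => [|n IH] nj.
  by rewrite big_nat1; case: i => [|i]/=; rewrite ?nj ?mulr1 ?mul1r ?mulr0 ?mul0r.
rewrite big_nat_recr//= nj andbT; have [le_in|lt_ni] := leqP i n.+1; last first.
  rewrite mulr0 addr0; apply: le_trans (IH (ltnW nj)) _.
  by rewrite ler_wpM2r// ler_nat leq_sub2r.
rewrite subSn// -natr1 mulrDl mul1r lerD ?mulr1 ?IH 1?ltnW//.
exact: s_dec.
Qed.

End weighted_sums.

(** * Weighted averages take no values outside the Birkhoff spectrum *)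

Section spectrum.
Context {R : realType}.
Implicit Types (s a b : R^nat) (alpha c C e : R).

(** Cutting off blocks of length [n] leaves less than [n] terms. *)
Lemma block_sums_lbound b n c : (0 < n)%N -> 0 <= c -> (forall k, - c <= b k) ->
  (forall k, 0 <= \sum_(0 <= l < n) b (k + l)%N) ->
  forall N, - (c * n%:R) <= \sum_(0 <= k < N) b k.
Proof.
move=> n0 c0 bc bn; elim/ltn_ind => N IH; have [Nn|nN] := ltnP N n.
  apply: (@le_trans _ _ (\sum_(0 <= k < N) - c)); last exact: ler_sum.
  rewrite sumr_const_nat subn0 mulNrn lerN2 -[c *+ N]mulr_natr.
  by rewrite ler_wpM2l// ler_nat ltnW.
rewrite (@big_cat_nat _ _ _ (N - n)%N)//= ?leq_subr//.
have -> : \sum_(N - n <= k < N) b k = \sum_(0 <= l < n) b (N - n + l)%N.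
  by rewrite -{1}[(N - n)%N]add0n big_addn subKn//; apply: eq_bigr => l _; rewrite addnC.
rewrite -[leLHS]addr0 lerD//; apply: IH; lia.
Qed.

(** Otherwise all blocks of length [n] would have a small average, and summation
    by parts would push the weighted averages below their limit. *)
Lemma large_block s a alpha C n : nonincreasing_seq s ->
  (forall n, 0 < s n) -> series s @ \oo --> +oo -> (forall k, `|a k| <= C) ->
  (fun n => (series s n)^-1 * \sum_(0 <= k < n) s k * a k) @ \oo --> alpha ->
  (0 < n)%N -> exists k, alpha * n%:R - 1 <= \sum_(0 <= l < n) a (k + l)%N.
Proof.
move=> s_dec s0 Sy aC cva n0; apply: contrapT => nok.
have small k : \sum_(0 <= l < n) a (k + l)%N <= alpha * n%:R - 1.
  by rewrite leNgt; apply/negP => /ltW ?; apply: nok; exists k.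
have nR : 0 < n%:R :> R by rewrite ltr0n.
pose b k := alpha - n%:R^-1 - a k.
pose c := `|alpha - n%:R^-1| + C.
have C0 : 0 <= C by apply: le_trans (aC 0%N); exact: normr_ge0.
have bc k : - c <= b k.
  have /ler_normlP[_ h1] := aC k.
  have := ler_norm (- (alpha - n%:R^-1)); rewrite normrN /b /c; lra.
have := @block_sums_lbound b n c n0 _ bc.
rewrite addr_ge0// => /(_ isT) blb.
have {}blb : forall N, - (c * n%:R) <= \sum_(0 <= k < N) b k.
  apply: blb => k; rewrite sumrB sumr_const_nat subn0 subr_ge0.
  apply: le_trans (small k) _.
  by rewrite -[leRHS]mulr_natr mulrBl mulVf ?gt_eqF.
have abl := abel_lower_bound s_dec (fun n => ltW (s0 n)) blb.
have e0 : 0 < n%:R^-1 / 4 :> R by rewrite divr_gt0// invr_gt0.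
have /average_cvgP /(_ _ e0) cve := cva.
have {}cve := cve (series_gt0 s0).
have near_lt : \forall N \near \oo, (0 < N)%N by exact: nbhs_infty_gt.
have [N [[N1 N2] N0]] := filter_ex (filterI (filterI cve
  (cvgy_absorb (c * n%:R * s 0%N) Sy e0)) near_lt).
have SN := series_gt0 s0 N0.
have := abl N.
have -> : \sum_(0 <= k < N) s k * b k =
    (alpha - n%:R^-1) * series s N - \sum_(0 <= k < N) s k * a k.
  by rewrite /series /= mulr_sumr -sumrB; apply: eq_bigr => k _; rewrite /b; ring.
move: N1; rewrite ler_norml => /andP[N1 _].
have : 0 < n%:R^-1 * series s N by rewrite mulr_gt0// invr_gt0.
move: N1 N2; lra.
Qed.

Lemma discrete_ivt (g : R^nat) c : 0 <= c ->
  (forall k, `|g k.+1 - g k| <= c) ->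
  (exists k, -1 <= g k) -> (exists k, g k <= 1) -> exists k, `|g k| <= c + 1.
Proof.
move=> c0 gS [i gi] [j gj]; apply: contrapT => nog.
have far k : g k < - (c + 1) \/ c + 1 < g k.
  have [|h] := ltP (g k) (- (c + 1)); [by left|right].
  rewrite ltNge; apply/negP => h'; apply: nog; exists k.
  by rewrite ler_norml h.
have [g0|g0] := far 0%N.
  suff /(_ i) : forall k, g k < - (c + 1) by lra.
  elim=> // k IH; have [//|] := far k.+1.
  by have := gS k; rewrite ler_norml; lra.
suff /(_ j) : forall k, c + 1 < g k by lra.
elim=> // k IH; have [|//] := far k.+1.
by have := gS k; rewrite ler_norml; lra.
Qed.

(** Sliding a block by one step changes its sum by at most [2 * C], so between
    a large block and a small one there is a balanced one. *)
Lemma balanced_block s a alpha C n : nonincreasing_seq s ->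
  (forall n, 0 < s n) -> series s @ \oo --> +oo -> (forall k, `|a k| <= C) ->
  (fun n => (series s n)^-1 * \sum_(0 <= k < n) s k * a k) @ \oo --> alpha ->
  exists k, `|\sum_(0 <= l < n) a (k + l)%N - alpha * n%:R| <= 2 * C + 1.
Proof.
move=> s_dec s0 Sy aC cva.
have C0 : 0 <= C by apply: le_trans (aC 0%N); exact: normr_ge0.
case: (posnP n) => [->|n0].
  by exists 0%N; rewrite big_geq// mulr0 subrr normr0; lra.
have [k1 k1P] := large_block s_dec s0 Sy aC cva n0.
have aCN k : `|- a k| <= C by rewrite normrN.
have cvaN : (fun n => (series s n)^-1 * \sum_(0 <= k < n) s k * - a k) @ \oo
    --> - alpha.
  rewrite (_ : (fun _ => _) = (fun n =>
    - ((series s n)^-1 * \sum_(0 <= k < n) s k * a k))); first exact: cvgN.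
  apply/funext => N; rewrite -mulrN -sumrN; congr (_ * _).
  by apply: eq_bigr => k _; rewrite mulrN.
have [k2 k2P] := large_block s_dec s0 Sy aCN cvaN n0.
rewrite sumrN in k2P.
apply: (@discrete_ivt
  (fun k => \sum_(0 <= l < n) a (k + l)%N - alpha * n%:R) (2 * C)).
- by rewrite mulr_ge0.
- move=> k; rewrite [X in `|X|](_ : _ = a (k + n)%N - a k).
    rewrite (le_trans (ler_normB _ _))//; have := aC (k + n)%N; have := aC k; lra.
  case: n {n0 k1P k2P} => [|n]; first by rewrite !big_geq// addn0; ring.
  rewrite big_nat_recr//= [in X in _ - X]big_nat_recl//=.
  rewrite addn0 addSnnS; under eq_bigr do rewrite addSnnS.
  by ring.
- by exists k1; lra.
- by exists k2; lra.
Qed.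

Lemma exists_block (a_ : nat -> nat) : a_ 0%N = 0%N ->
  (forall k, (a_ k < a_ k.+1)%N) -> forall n, exists k, (a_ k <= n < a_ k.+1)%N.
Proof.
move=> a0 aS; elim=> [|n [k /andP[kn]]].
  by exists 0%N; rewrite a0/= -{1}a0.
rewrite leq_eqVlt => /predU1P[nk|nk]; last by exists k; rewrite nk ltnW.
by exists k.+1; rewrite nk leqnn aS.
Qed.

(** Gluing balanced blocks of slowly growing length produces a Birkhoff average
    equal to [alpha]: the error made on a block is bounded by a constant, up to
    an arbitrarily small multiple of the length of the block. *)
Lemma balanced_blocks_spectrum K (A : 'M[nat]_K) r (phi : fullshift R K -> R)
    alpha c :
  gluing_time (R := R) A r -> {within sft R A, continuous phi} ->
  (forall n, exists2 x, sft R A x &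
    `|\sum_(0 <= l < n) phi (iter l left_shift x) - alpha * n%:R| <= c) ->
  birkhoff_spectrum A phi alpha.
Proof.
move=> gl phi_c bal.
have /choice[x_ x_P] n : exists x, sft R A x /\
    `|\sum_(0 <= l < n) phi (iter l left_shift x) - alpha * n%:R| <= c.
  by have [x] := bal n; exists x.
have xA n : sft R A (x_ n) by case: (x_P n).
have xc n : `|\sum_(0 <= l < n) phi (iter l left_shift (x_ n)) - alpha * n%:R| <= c.
  by case: (x_P n).
(* The starting times [a_ k] are quadratic, so that the length [L k] of a block is
   negligible with respect to its starting time. *)
pose L k := (2 * k + 1 + r)%N; pose a_ k := (k * (k + r))%N.
have aS k : a_ k.+1 = (a_ k + L k)%N by rewrite /a_ /L; nia.
have [||k|y yA yx] := specification (x_ := fun k => x_ (L k)) (a_ := a_) gl.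
- by move=> k; exact: xA.
- by [].
- by rewrite aS leq_add2l /L leq_addl.
exists y => //; apply/(average_cvgP (fun n => \sum_(0 <= k < n)
  phi (iter k left_shift y)) alpha) => [n n0|e e0]; first by rewrite ltr0n.
have e40 : 0 < e / 4 by rewrite divr_gt0.
have [m [C mC]] := continuous_uniform phi_c e40.
have C0 : 0 <= C.
  by have [/(le_trans (normr_ge0 _))] := mC y y yA yA.
pose f k := phi (iter k left_shift y) - alpha.
pose M := C + `|alpha|; pose c' := c + 2 * C * (r + m)%:R.
have fM k : `|f k| <= M.
  rewrite (le_trans (ler_normB _ _))// lerD2r.
  by have yk := sft_iter_shift k yA; have [] := mC _ _ yk yk.
have c0 : 0 <= c by apply: le_trans (xc 0%N); exact: normr_ge0.
have c'0 : 0 <= c' by rewrite addr_ge0// !mulr_ge0.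
have M0 : 0 <= M by rewrite addr_ge0.
have block k : `|\sum_(0 <= l < L k) f (a_ k + l)%N| <= c' + e / 4 * (L k)%:R.
  have -> : \sum_(0 <= l < L k) f (a_ k + l)%N =
      \sum_(0 <= l < L k) (phi (iter (a_ k + l) left_shift y) -
                           phi (iter l left_shift (x_ (L k)))) +
      (\sum_(0 <= l < L k) phi (iter l left_shift (x_ (L k))) - alpha * (L k)%:R).
    by rewrite !sumrB sumr_const_nat subn0 mulr_natr addrA subrK.
  rewrite (le_trans (ler_normD _ _))// /c' -addrA [c + _]addrC lerD//.
  rewrite (le_trans (ler_norm_sum _ _ _))//.
  apply: (@le_trans _ _ (\sum_(0 <= l < L k)
      (e / 4 + 2 * C * (1 * (L k - (r + m) <= l < L k)%N%:R)))).
    rewrite big_nat [leRHS]big_nat; apply: ler_sum => l /andP[_ lL].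
    have yl := sft_iter_shift (a_ k + l) yA.
    have xl := sft_iter_shift l (xA (L k)).
    rewrite lL andbT mul1r; have [le_l|lt_l] := leqP.
      rewrite mulr1 (le_trans (ler_normB _ _))//.
      have [] := mC _ _ yl xl; have [] := mC _ _ xl yl; lra.
    rewrite mulr0 addr0; have [_] := mC _ _ yl xl; apply.
    move=> j jm; rewrite !iter_shiftE -addnA yx// aS -addnA leq_add2l; lia.
  rewrite big_split/= sumr_const_nat subn0 [leLHS]addrC -[e / 4 *+ _]mulr_natr.
  rewrite lerD2r -mulr_sumr ler_wpM2l ?mulr_ge0//.
  apply: le_trans (@sum_window R (fun=> 1) _ _ _ _ _) _ => //.
  by rewrite mulr1 ler_nat; lia.
have Fa k : `|\sum_(0 <= j < a_ k) f j| <= c' * k%:R + e / 4 * (a_ k)%:R.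
  elim: k => [|k IH]; first by rewrite big_geq// normr0 mulr0 add0r mulr_ge0// ltW.
  rewrite aS (@big_cat_nat _ _ _ (a_ k))//= ?leq_addr//.
  rewrite -{2}[a_ k]add0n big_addn addKn.
  under [X in _ + X]eq_bigr do rewrite addnC.
  rewrite (le_trans (ler_normD _ _))//.
  have := block k; rewrite natrD -[k.+1%:R]natr1; lra.
pose c2 := c' + M * (2 + r)%:R.
have c20 : 0 <= c2 by rewrite addr_ge0// mulr_ge0.
have Ny : (fun n => n%:R : R) @ \oo --> +oo by exact: cvgr_idn.
have := cvgy_absorb (c2 + c2 ^+ 2 / e) Ny e40.
apply: filterS => n nbig.
have [//|k|k /andP[kn nk]] := @exists_block a_ _ _ n.
  by rewrite aS /L; lia.
have -> : \sum_(0 <= j < n) phi (iter j left_shift y) - alpha * n%:R =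
    \sum_(0 <= j < n) f j.
  by rewrite sumrB sumr_const_nat subn0 mulr_natr.
rewrite (@big_cat_nat _ _ _ (a_ k))//= (le_trans (ler_normD _ _))//.
have tail : `|\sum_(a_ k <= j < n) f j| <= M * (L k)%:R.
  rewrite (le_trans (ler_norm_sum _ _ _))//.
  apply: (@le_trans _ _ (\sum_(a_ k <= j < n) M)); first exact: ler_sum.
  rewrite sumr_const_nat -[M *+ _]mulr_natr ler_wpM2l// ler_nat.
  by rewrite aS in nk; lia.
have LE : M * (L k)%:R <= M * (2 + r)%:R * (k%:R + 1).
  rewrite -[leRHS]mulrA ler_wpM2l// natr1 -natrM ler_nat /L; nia.
have kk : k%:R * k%:R <= n%:R :> R.
  by rewrite -natrM ler_nat (leq_trans _ kn)// /a_ leq_mul2l leq_addr orbT.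
have an : e / 4 * (a_ k)%:R <= e / 4 * n%:R by rewrite ler_wpM2l ?ler_nat// ltW.
(* The error is linear in [k], whereas [n] is at least quadratic in [k]. *)
have ck : c2 * k%:R <= e / 4 * (k%:R * k%:R) + c2 ^+ 2 / e.
  rewrite -subr_ge0.
  have -> : e / 4 * (k%:R * k%:R) + c2 ^+ 2 / e - c2 * k%:R =
     (e / 2 * k%:R - c2) ^+ 2 / e by field; rewrite gt_eqF.
  by rewrite divr_ge0 ?sqr_ge0// ltW.
have kk' : e / 4 * (k%:R * k%:R) <= e / 4 * n%:R by rewrite ler_wpM2l// ltW.
have c2k : c2 * k%:R = c' * k%:R + M * (2 + r)%:R * k%:R by rewrite mulrDl.
have c2M : M * (2 + r)%:R <= c2 by rewrite lerDr.
have en : 0 <= e * n%:R by rewrite mulr_ge0// ltW.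
move: (c2 ^+ 2 / e) ck nbig => q ck nbig; have := Fa k.
by move: (M * (2 + r)%:R) LE c2k c2M => Mr; clearbody c2 c'; lra.
Qed.

(** The orbit of [x] itself contains balanced blocks of all lengths. *)
Lemma weighted_level_set_spectrum K (A : 'M[nat]_K) r s
    (phi : fullshift R K -> R) alpha x :
  gluing_time (R := R) A r -> {within sft R A, continuous phi} ->
  nonincreasing_seq s -> (forall n, 0 < s n) -> series s @ \oo --> +oo ->
  weighted_level_set A s phi alpha x -> birkhoff_spectrum A phi alpha.
Proof.
move=> gl phi_c s_dec s0 Sy [xA cvx].
have [m [C mC]] := continuous_uniform phi_c ltr01.
apply: (balanced_blocks_spectrum (c := 2 * C + 1) gl phi_c) => n.
have [|k kn] := balanced_block (C := C) n s_dec s0 Sy _ cvx.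
  move=> k; have xk := sft_iter_shift k xA.
  by have [] := mC _ _ xk xk.
exists (iter k left_shift x); first exact: sft_iter_shift.
move: kn; rewrite (eq_bigr (fun l => phi (iter l left_shift
  (iter k left_shift x))))// => l _.
by rewrite addnC iterD.
Qed.

End spectrum.

(** * Counting words *)

Section words.
Context {R : realType} {K : nat} (A : 'M[nat]_K).
Implicit Types (x y : fullshift R K) (n m : nat) (e t : R).

Definition word n x : {ffun 'I_n -> 'I_K} := [ffun j => x (val j)].

Lemma wordP n x y : word n x = word n y <-> agree n x y.
Proof.
split=> [/ffunP xy j jn|xy]; last first.
  by apply/ffunP => j; rewrite !ffunE; apply: xy; exact: ltn_ord.
by have := xy (Ordinal jn); rewrite !ffunE.
Qed.

Definition words n : {set {ffun 'I_n -> 'I_K}} :=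
  finset (fun w => `[< exists2 x : fullshift R K, sft R A x & word n x = w >]).

Definition nwords n := #|words n|.

Lemma mem_words n x : sft R A x -> word n x \in words n.
Proof. by move=> xA; rewrite inE; apply/asboolP; exists x. Qed.

Lemma words_section n x0 : sft R A x0 ->
  exists2 f : {ffun 'I_n -> 'I_K} -> fullshift R K,
    forall w, sft R A (f w) & {in words n, cancel f (word n)}.
Proof.
move=> x0A.
have /choice[f fP] (w : {ffun 'I_n -> 'I_K}) : exists x,
    sft R A x /\ (w \in words n -> word n x = w).
  have [|_] := boolP (w \in words n); last by exists x0.
  by rewrite inE => /asboolP[x xA xw]; exists x.
exists f => [w|w ww]; first by case: (fP w).
by have [_ ->] := fP w.
Qed.

Variables (x0 : fullshift R K) (x0A : sft R A x0).

Lemma nwords_gt0 n : (0 < nwords n)%N.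
Proof. by apply/card_gt0P; exists (word n x0); exact: mem_words. Qed.

Lemma leq_nwords m n : (m <= n)%N -> (nwords m <= nwords n)%N.
Proof.
move=> mn; have [f fA fK] := words_section m x0A.
rewrite /nwords -(@card_in_imset _ _ (fun w => word n (f w))); last first.
  move=> v w vW wW /= /wordP vw; rewrite -(fK v)// -(fK w)//.
  by apply/wordP; exact: agree_le vw.
by apply/subset_leq_card/fintype.subsetP => _ /imsetP[w _ ->]; exact: mem_words.
Qed.

Lemma nwordsD m n : (nwords (m + n) <= nwords m * nwords n)%N.
Proof.
have [f fA fK] := words_section (m + n) x0A.
rewrite /nwords -cardsX -(@card_in_imset _ _
  (fun w => (word m (f w), word n (iter m left_shift (f w))))); last first.
  move=> v w vW wW /= [/wordP vw1 /wordP vw2]; rewrite -(fK v)// -(fK w)//.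
  apply/wordP => j jmn; have [/vw1//|mj] := ltnP j m.
  have := vw2 (j - m)%N; rewrite !iter_shiftE subnKC//; apply; lia.
apply/subset_leq_card/fintype.subsetP => _ /imsetP[w _ ->].
by rewrite finset.in_setX !mem_words//; exact: sft_iter_shift.
Qed.

Lemma nwordsM q m : (nwords (q * m) <= nwords m ^ q)%N.
Proof.
elim: q => [|q IH]; last first.
  by rewrite mulSn expnS (leq_trans (nwordsD _ _))// leq_mul2l IH orbT.
rewrite mul0n expn0; apply/card_le1_eqP => v w _ _.
by apply/ffunP => -[].
Qed.

Lemma nwords_pow m n : (0 < m)%N -> (nwords n <= nwords m ^ (n %/ m).+1)%N.
Proof.
move=> m0; apply: leq_trans (nwordsM _ _); apply: leq_nwords.
by rewrite ltnW// ltn_ceil.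
Qed.

(** ** Words and separated sets *)

(** Points with distinct words of length [n] are at distance [1] at some time
    before [n]. *)
Lemma nwords_le_separated n e : e < 1 ->
  ((nwords n)%:R%:E <= max_separated (@left_shift R K) (sft R A) n e)%E.
Proof.
move=> e1; have [f fA fK] := words_section n x0A.
apply: ereal_sup_ubound; exists [fset f w | w in words n]%fset.
  split=> [_ /imfsetP[w _ ->]//|x y /imfsetP[v vW ->] /imfsetP[w wW ->] vw].
  have [k kn fk] : exists2 k, (k < n)%N & f v k != f w k.
    apply: contrapT => nok; apply: vw; congr f.
    rewrite -(fK v)// -(fK w)//; apply/wordP => k kn.
    by apply/eqP/negPn/negP => fk; apply: nok; exists k.
  exists k => //; apply: lt_le_trans e1 _; rewrite -[leLHS]expR0 -oppr0.
  by apply: (mdist_ge_expR (n := 0)); rewrite !iter_shiftE addn0.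
rewrite card_in_imfset/=; first rewrite /nwords cardE.
  by congr (_%:R%:E); apply/perm_size/uniq_perm; rewrite ?enum_uniq ?enum_finmem_uniq//.
by move=> v w vW wW /(congr1 (word n)); rewrite !fK.
Qed.

(** Orbits that are separated at scale [expR (- m%:R)] before time [n] differ
    within the first [n + m] letters. *)
Lemma separated_le_nwords n m e : expR (- m%:R) <= e ->
  (max_separated (@left_shift R K) (sft R A) n e <= (nwords (n + m))%:R%:E)%E.
Proof.
move=> me; apply: ge_ereal_sup => _ [F [FA Fsep] <-]; rewrite lee_fin ler_nat.
rewrite /nwords -(size_map (word (n + m))); set W := map _ _.
have uW : uniq W.
  rewrite map_inj_in_uniq ?fset_uniq// => x y xF yF /wordP xy.
  apply: contrapT => nxy; have [k kn] := Fsep x y xF yF nxy.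
  apply/negP; rewrite -leNgt (le_trans _ me)//; apply/mdist_agree => j jm.
  by rewrite !iter_shiftE xy//; lia.
rewrite -(card_uniqP uW); apply/subset_leq_card/fintype.subsetP => w.
by move=> /mapP[x xF ->]; apply: mem_words; exact: FA.
Qed.

Lemma limn_esup_le_near (u : (\bar R)^nat) l :
  (\forall n \near \oo, (u n <= l)%E) -> (limn_esup u <= l)%E.
Proof.
move=> ul; apply: ereal_inf_le.
exists (ereal_sup [set u x | x in [set n | (u n <= l)%E]]).
  by exists [set n | (u n <= l)%E].
by apply: ge_ereal_sup => _ [n /= un <-].
Qed.

Lemma limn_esup_lt_near (u : (\bar R)^nat) l :
  (limn_esup u < l)%E -> \forall n \near \oo, (u n < l)%E.
Proof.
move=> /ereal_inf_lt[_ [V Voo <-]] Vl; apply: filterS Voo => n Vn.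
by apply: le_lt_trans Vl; apply: ereal_sup_ubound; exists n.
Qed.

(** By submultiplicativity a single deficient word count would bound the whole
    exponential growth. *)
Lemma expR_le_nwords t n : (t%:E < top_entropy (@left_shift R K) (sft R A))%E ->
  expR (t * n%:R) <= (nwords n)%:R.
Proof.
case: n => [_|n]; first by rewrite mulr0 expR0 ler1n nwords_gt0.
move=> /ereal_sup_gt[_ [e /= e0 <-]]; rewrite ltNge => /negP nlim.
rewrite leNgt; apply/negP => Wt; apply: nlim.
have [m me] := expRN_le_exists e0.
set N := n.+1 in Wt *.
have W0 : 0 < (nwords N)%:R :> R by rewrite ltr0n nwords_gt0.
pose h := ln ((nwords N)%:R : R) / N%:R.
have N0 : 0 < N%:R :> R by rewrite ltr0n.
have h0 : 0 <= h by rewrite divr_ge0// ln_ge0// ler1n nwords_gt0.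
have ht : h < t.
  by rewrite ltr_pdivrMr// -[ltRHS]expRK ltr_ln// posrE expR_gt0.
have th : 0 < t - h by rewrite subr_gt0.
have Ny : (fun n => n%:R : R) @ \oo --> +oo by exact: cvgr_idn.
apply: limn_esup_le_near.
have := cvgy_absorb (h * (m + N)%:R) Ny th.
apply: filterS2 (nbhs_infty_gt 0) => k k0 kbig.
have k0R : 0 < k%:R :> R by rewrite ltr0n.
apply: (@le_trans _ _ ((k%:R^-1)%:E * (ln ((nwords (k + m))%:R : R))%:E)%E).
  rewrite lee_wpmul2l ?lee_fin ?invr_ge0// -lne_EFin ?ltr0n ?nwords_gt0//.
  rewrite lee_lne; first exact: separated_le_nwords.
    by rewrite in_itv/= leey andbT; apply: ereal_sup_ubound; exists fset0.
  by rewrite in_itv/= leey lee_fin ler0n.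
rewrite -EFinM lee_fin mulrC ler_pdivrMr//.
have : ln ((nwords (k + m))%:R : R) <= h * (k + m + N)%:R.
  apply: (@le_trans _ _ (ln ((nwords N ^ ((k + m) %/ N).+1)%:R : R))).
    rewrite ler_ln ?posrE ?ltr0n ?expn_gt0 ?nwords_gt0// ler_nat.
    exact: nwords_pow.
  have hN : ln ((nwords N)%:R : R) = h * N%:R by rewrite divfK// gt_eqF.
  rewrite natrX lnXn// hN -[_ *+ _.+1]mulr_natr -mulrA.
  rewrite ler_wpM2l// -natrM ler_nat mulnS addnC leq_add2r mulnC.
  exact: leq_trunc_div.
by move: kbig; rewrite -addnA natrD; lra.
Qed.

Lemma nwords_lt_expR t : (top_entropy (@left_shift R K) (sft R A) < t%:E)%E ->
  \forall n \near \oo, (nwords n)%:R < expR (t * n%:R).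
Proof.
move=> ht; have half1 : 2^-1 < 1 :> R by lra.
have half0 : 0 < 2^-1 :> R by lra.
have /limn_esup_lt_near : (limn_esup (fun n => n%:R^-1%:E * lne (max_separated
    (@left_shift R K) (sft R A) n 2^-1)) < t%:E)%E.
  by apply: le_lt_trans ht; apply: ereal_sup_ubound; exists 2^-1.
apply: filterS2 (nbhs_infty_gt 0) => n n0.
have n0R : 0 < n%:R :> R by rewrite ltr0n.
have W0 : 0 < (nwords n)%:R :> R by rewrite ltr0n nwords_gt0.
move=> nt; rewrite -[ltLHS]lnK ?posrE// ltr_expR -ltr_pdivrMr// mulrC.
rewrite -lte_fin; apply: le_lt_trans nt; rewrite EFinM.
rewrite lee_wpmul2l ?lee_fin ?invr_ge0// -lne_EFin// lee_lne.
- exact: nwords_le_separated.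
- by rewrite in_itv/= leey lee_fin ler0n.
- rewrite in_itv/= leey andbT (le_trans _ (nwords_le_separated n half1))//.
Qed.

Lemma top_entropy_ge0 : (0 <= top_entropy (@left_shift R K) (sft R A))%E.
Proof.
rewrite leNgt; apply/negP => /nwords_lt_expR /filter_ex[n].
by rewrite mul0r expR0 ltrn1 ltnNge nwords_gt0.
Qed.

End words.

(** * Packing dimension of subsets of the subshift *)

Section packing_upper.
Context {R : realType} {K : nat} (A : 'M[nat]_K).
Implicit Types (E : set (fullshift R K)) (B : set (fullshift R K * R)) (s t : R).

(** Each ball of a packing contains a cylinder of comparable size, and distinct
    balls contain distinct cylinders: at scale [expR (- n%:R)] there are at most
    as many balls as words of length [n]. *)
Lemma packing_sum_le E t d B (X : seq (fullshift R K * R)) n0 : 0 <= t ->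
  E `<=` sft R A -> d <= expR (- n0%:R) -> is_packing E d B ->
  uniq X -> {in X, forall b, B b} ->
  exists N, \sum_(b <- X) (2 * b.2) `^ t <=
    \sum_(n0 <= n < N) (nwords (R := R) A n)%:R * (2 * expR (1 - n%:R)) `^ t.
Proof.
move=> t0 EA dn0 [_ BE Bdisj] uX XB.
have scale b : exists n, B b -> [/\ (n0 <= n)%N, expR (- n%:R) <= b.2 &
    b.2 <= expR (1 - n%:R)].
  have [Bb|] := pselect (B b); last by exists 0%N.
  have [Eb /andP[b0 bd]] := BE _ Bb.
  have exn := expRN_le_exists b0.
  exists (ex_minn exn) => _; case: ex_minnP => n nb nmin; split=> //.
    by rewrite -(ler_nat R) -lerN2 -ler_expR (le_trans nb)// (le_trans bd).
  case: n nb nmin => [|n] nb nmin.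
    rewrite (le_trans bd)// (le_trans dn0)// ler_expR subr0.
    by rewrite (@le_trans _ _ 0)// oppr_le0.
  rewrite leNgt; apply/negP => lt_b; suff /nmin : expR (- n%:R) <= b.2.
    by rewrite ltnn.
  by rewrite (le_trans _ (ltW lt_b))// ler_expR -[n.+1%:R]natr1; lra.
have [lev levP] := choice scale.
exists (\max_(b <- X) lev b).+1; set N := (\max_(b <- X) lev b).
have levX b : b \in X -> (n0 <= lev b < N.+1)%N.
  by move=> bX; have [-> _ _] := levP b (XB b bX); rewrite ltnS leq_bigmax_seq.
apply: (@le_trans _ _ (\sum_(b <- X) \sum_(n0 <= n < N.+1)
    (lev b == n)%:R * (2 * expR (1 - n%:R)) `^ t)).
  rewrite big_seq [leRHS]big_seq; apply: ler_sum => b bX.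
  have [_ lb bl] := levP b (XB b bX).
  rewrite (bigD1_seq (lev b)) ?iota_uniq ?mem_index_iota ?levX//=.
  rewrite eqxx mul1r -[leLHS]addr0 lerD//; last first.
    by apply: sumr_ge0 => n _; rewrite mulr_ge0// powR_ge0.
  have b0 : 0 <= b.2 by exact: le_trans (expR_ge0 _) lb.
  by rewrite ge0_ler_powR ?nnegrE ?mulr_ge0 ?expR_ge0// ler_wpM2l.
rewrite exchange_big/=; apply: ler_sum => n _.
rewrite -mulr_suml ler_wpM2r ?powR_ge0// -natr_sum ler_nat.
rewrite -big_mkcond/= sum1_count -size_filter.
rewrite -(size_map (fun b => word n b.1)) /nwords; set W := map _ _.
have uW : uniq W.
  rewrite map_inj_in_uniq ?filter_uniq// => b c.
  rewrite !mem_filter => /andP[/eqP nb bX] /andP[/eqP nc cX] /wordP bc.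
  apply: Bdisj; [exact: XB|exact: XB|].
  have [_ lb _] := levP b (XB b bX); have [_ lc _] := levP c (XB c cX).
  exists c.1; split; rewrite /cball/=; last first.
    by rewrite mdistxx; apply: le_trans (expR_ge0 _) lc.
  by apply: le_trans lb; apply/mdist_agree; rewrite nb.
rewrite -(card_uniqP uW); apply/subset_leq_card/fintype.subsetP => w.
move=> /mapP[b]; rewrite mem_filter => /andP[_ bX] ->; apply: mem_words.
by apply: EA; have [] := BE b (XB b bX).
Qed.

Lemma packing_content_ge0 s d E : (0 <= packing_content s d E)%E.
Proof.
apply: ereal_sup_ubound; exists set0; last by rewrite esum_set0.
by split => //; exact: trivIset_set0.
Qed.

(** By [packing_sum_le] the packing content at scale [expR (- n0%:R)] is at most
    the tail from [n0] of a geometric series of ratio [expR (s - t)]. *)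
Lemma packing_measure_eq0 E s t : 0 <= t -> s < t -> E `<=` sft R A ->
  (\forall n \near \oo, (nwords (R := R) A n)%:R <= expR (s * n%:R)) ->
  packing_measure t E = 0%E.
Proof.
move=> t0 st EA [N1 _ WN].
pose q := expR (s - t); pose c := 2 `^ t * expR t.
have q0 : 0 < q by exact: expR_gt0.
have q1 : q < 1 by rewrite expR_lt1 subr_lt0.
have c0 : 0 <= c by rewrite mulr_ge0 ?powR_ge0 ?expR_ge0.
have content n0 : (N1 <= n0)%N ->
    (packing_content t (expR (- n0%:R)) E <= (c / (1 - q) * q ^+ n0)%:E)%E.
  move=> Nn0; apply: ge_ereal_sup => _ [B Bpack <-].
  apply: ge_ereal_sup => _ [X [finX XB] <-].
  rewrite fsbig_finite//= sumEFin lee_fin.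
  have XB' : {in fset_set X : seq _, forall b, B b}.
    by move=> b; rewrite in_fset_set// inE; exact: XB.
  have [N] := packing_sum_le t0 EA (lexx _) Bpack (fset_uniq (fset_set X)) XB'.
  move/le_trans; apply.
  apply: (@le_trans _ _ (\sum_(n0 <= n < N) c * q ^+ n)).
    rewrite big_nat [leRHS]big_nat; apply: ler_sum => n /andP[n0n _].
    apply: (@le_trans _ _ (expR (s * n%:R) * (2 * expR (1 - n%:R)) `^ t)).
      by rewrite ler_wpM2r ?powR_ge0//; apply: WN; exact: leq_trans n0n.
    rewrite powRM ?expR_ge0// -expRM mulrCA /c -mulrA ler_wpM2l ?powR_ge0//.
    rewrite /q -expRM_natr -!expRD ler_expR; lra.
  have [nN|Nn] := leqP n0 N; last first.
    by rewrite big_geq 1?ltnW// mulr_ge0 ?divr_ge0 ?subr_ge0 ?exprn_ge0// ltW.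
  rewrite -mulr_sumr -mulrA ler_wpM2l// mulrC ler_pdivlMr ?subr_gt0//.
  have -> : (\sum_(n0 <= n < N) q ^+ n) * (1 - q) = q ^+ n0 - q ^+ N.
    rewrite mulrBr mulr1 mulr_suml -sumrB.
    under eq_bigr do rewrite -exprSr -opprB.
    by rewrite sumrN telescope_sumr// opprB.
  by rewrite gerBl exprn_ge0// ltW.
have pre0 : packing_premeasure t E = 0%E.
  apply/eqP; rewrite eq_le; apply/andP; split; last first.
    by apply: le_ereal_inf_tmp => _ [d _ <-]; exact: packing_content_ge0.
  apply/lee_addgt0Pr => e e0; rewrite add0e.
  have : (c / (1 - q)) * q ^+ n @[n --> \oo] --> 0.
    by rewrite -(mulr0 (c / (1 - q))); apply: cvgMr; apply: cvg_expr;
      rewrite ger0_norm// ltW.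
  move=> /cvgrPdist_le /(_ _ e0) /(filterI (nbhs_infty_ge N1)).
  move=> /filter_ex[n [/= N1n]]; rewrite sub0r normrN => qe.
  apply: (@le_trans _ _ (packing_content t (expR (- n%:R)) E)).
    by apply: ereal_inf_lbound; exists (expR (- n%:R)) => //=; exact: expR_gt0.
  apply: (le_trans (content n N1n)).
  by rewrite lee_fin (le_trans (ler_norm _)).
apply/eqP; rewrite eq_le; apply/andP; split.
  apply: ereal_inf_lbound; exists (fun=> E); first by move=> x Ex; exists 0%N.
  by rewrite eseries0.
apply: le_ereal_inf_tmp => _ [F _ <-]; apply: nneseries_ge0 => n _ _.
by apply: le_ereal_inf_tmp => _ [d _ <-]; exact: packing_content_ge0.
Qed.

End packing_upper.

Section packing_lower.
Context {R : realType} {K : nat} (A : 'M[nat]_K).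
Implicit Types (E : set (fullshift R K)) (x y z : fullshift R K) (s t : R).

Lemma packing_content_ge (I : finType) (P : {set I}) (y_ : I -> fullshift R K)
    N s d E : 0 <= s -> {in P, forall u, E (y_ u)} ->
  {in P &, forall u v, agree N (y_ u) (y_ v) -> u = v} ->
  expR (- N%:R) <= d ->
  ((#|P|%:R * (2 * expR (- N%:R)) `^ s)%:E <= packing_content s d E)%E.
Proof.
move=> s0 yE yinj Nd; pose f u := (y_ u, expR (- N%:R) : R).
have finj : set_inj [set` enum P] f.
  move=> u v; rewrite !inE /= !fintype.mem_enum => uP vP [yuv].
  by apply: yinj => //; rewrite yuv.
apply: ereal_sup_ubound; exists (f @` [set` enum P]).
  split.
  - exact: finite_set_countable (finite_image _ (finite_seq _)).
  - move=> _ [u /= + <-]; rewrite fintype.mem_enum => uP.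
    by rewrite expR_gt0 Nd; split=> //; exact: yE.
  - move=> _ _ [u /= + <-] [v /= + <-] [z [/= /mdist_agree uz /mdist_agree vz]].
    rewrite !fintype.mem_enum => uP vP; congr f; apply: yinj => //.
    exact: agree_trans uz (agree_sym vz).
rewrite esum_image// esum_fset//; last first.
  by move=> u _; rewrite lee_fin powR_ge0.
rewrite -fsbig_seq ?enum_uniq//= sumEFin big_enum sumr_const.
by congr EFin; rewrite [RHS]mulr_natl.
Qed.

(** The Baire category theorem: if no [G i] were dense in a cylinder, a nested
    sequence of cylinders would avoid all of them. *)
Lemma dense_cylinder (G : nat -> set (fullshift R K)) x0 : sft R A x0 ->
  sft R A `<=` \bigcup_i G i ->
  exists i z0 p, sft R A z0 /\ forall z, sft R A z -> agree p z0 z ->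
    forall q, exists z', [/\ sft R A z', G i z' & agree q z z'].
Proof.
move=> x0A cover; apply: contrapT => nodense.
have step i (zp : {z | sft R A z} * nat) : {zp' : {z | sft R A z} * nat |
    [/\ agree zp.2 (sval zp.1) (sval zp'.1), (zp.2 < zp'.2)%N &
        forall z, sft R A z -> agree zp'.2 (sval zp'.1) z -> ~ G i z]}.
  case: zp => -[z0 z0A] p /=; apply: cid; apply: contrapT => nostep.
  apply: nodense; exists i, z0, p; split=> // z zA z0z q; apply: contrapT => noz'.
  apply: nostep; exists (exist _ z zA, maxn p.+1 q); split=> //=.
    by rewrite leq_max leqnn.
  move=> z' z'A zz' Gz'; apply: noz'; exists z'; split=> //.
  by apply: agree_le zz'; rewrite leq_max leqnn orbT.
pose zp := fix zp i := if i is i'.+1 then sval (step i' (zp i'))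
                       else (exist (sft R A) x0 x0A, 0%N).
have zpS i := svalP (step i (zp i)).
have [i|i|i|z zA zz] := @nested_cylinders _ _ A
    (fun i => sval (zp i).1) (fun i => (zp i).2).
- exact: (svalP (zp i).1).
- by have [] := zpS i.
- by have [] := zpS i.
have [i _ Giz] := cover z zA; have [_ _ /(_ z zA)] := zpS i; apply => //.
exact: (zz i.+1).
Qed.

(** The number of words of the length of the [k]-th window, bounded below by
    [expR_le_nwords], outweighs the size of the balls when [t > s], since the
    window is almost as long as the radius exponent [k.+2 * n]. *)
Lemma packing_growth s t r n k : 0 <= s -> s < t -> (k <= n)%N ->
  t <= (t - s) * k%:R ->
  2 * (t - s) * k%:R - 2 * t * r%:R <=
  expR (t * (k.+2 * n - n - 2 * r)%:R) * (2 * expR (- (k.+2 * n)%:R)) `^ s.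
Proof.
move=> s0 st kn tk; have t0 : 0 < t by exact: le_lt_trans st.
rewrite powRM ?expR_ge0// -expRM mulrCA.
apply: (@le_trans _ _ (expR (t * (k.+2 * n - n - 2 * r)%:R) *
    expR (- (k.+2 * n)%:R * s))); last first.
  rewrite ler_peMl ?mulr_ge0 ?expR_ge0// -[leLHS](powRr0 2) ler_powR//; lra.
rewrite -expRD; apply: le_trans (expR_ge1Dx _).
have : t * ((k.+2 * n)%:R - n%:R - 2 * r%:R) <= t * (k.+2 * n - n - 2 * r)%:R.
  rewrite ler_wpM2l ?(ltW t0)// !lerBlDr -!natrM -!natrD ler_nat; lia.
have : 0 <= n%:R * ((t - s) * k%:R - t) by rewrite mulr_ge0// subr_ge0.
have : 0 <= (t - s) * (n%:R - k%:R) by rewrite mulr_ge0 ?subr_ge0 ?ler_nat// ltW.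
rewrite natrM -[k.+2%:R]natr1 -[k.+1%:R]natr1; lra.
Qed.

Lemma window_index N n r j : (j < N - n - 2 * r)%N -> (n + r + j + r < N)%N.
Proof. lia. Qed.

(** A map that copies its argument on arbitrarily long windows spreads the
    subshift over a set of full packing dimension. In a countable cover of the
    image, some member has a preimage which is dense in a cylinder, hence
    contains points whose images show every word in a late window; the length of
    the window eventually exceeds any multiple of the time at which it starts. *)
Lemma packing_premeasure_window r (n_ : nat -> nat)
    (Phi : fullshift R K -> fullshift R K) (F : (set (fullshift R K))^nat) s t x0 :
  gluing_time (R := R) A r -> sft R A x0 -> 0 <= s -> s < t ->
  (t%:E < top_entropy (@left_shift R K) (sft R A))%E ->
  (forall k, (k <= n_ k)%N) ->
  (forall z, sft R A z -> forall k j, (n_ k + r <= j)%N ->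
     (j + r <= k.+2 * n_ k)%N -> Phi z j = z j) ->
  Phi @` sft R A `<=` \bigcup_i F i ->
  exists i, packing_premeasure s (F i) = +oo%E.
Proof.
move=> [_ gl] x0A s0 st th n_k Phiz cover.
have t0 : 0 < t by exact: le_lt_trans st.
have [|i [z0 [p [z0A dense]]]] := @dense_cylinder (fun i => Phi @^-1` F i) x0 x0A.
  by move=> z zA; have [|i _ Fi] := cover (Phi z); [exists z|exists i].
exists i; apply/eqP; rewrite eq_le leey/=.
apply: le_ereal_inf_tmp => _ [d /= d0 <-]; rewrite leye_eq; apply/eqP/eqyP => C C0.
have st0 : 0 < t - s by rewrite subr_gt0.
have Ny : (fun n => n%:R : R) @ \oo --> +oo by exact: cvgr_idn.
have st20 : 0 < 2 * (t - s) by rewrite mulr_gt0.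
have [k [[[kp kd] kt] kC]] := filter_ex (filterI (filterI (filterI
  (nbhs_infty_ge p) (cvgy_absorb d^-1 Ny ltr01)) (cvgy_absorb t Ny st0))
  (cvgy_absorb (C + 2 * t * r%:R) Ny st20)).
pose N := (k.+2 * n_ k)%N; pose l := (N - n_ k - 2 * r)%N.
have [f fA fK] := words_section l x0A.
have /choice[y_ yP] (u : {ffun 'I_l -> 'I_K}) : exists y, F i y /\
    forall j : nat, (j < l)%N -> y (n_ k + r + j)%N = f u j.
  have [w wA [zw wf]] := gl z0 (f u) (n_ k) z0A (fA u).
  have [z [zA Fz wz]] : exists z', [/\ sft R A z', (Phi @^-1` F i) z' & agree N w z'].
    apply: dense => //; apply: agree_le zw.
    by rewrite (leq_trans kp)// (leq_trans (n_k k)).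
  exists (Phi z); split=> // j jl.
  have jN := window_index jl.
  rewrite (Phiz z zA k) ?leq_addr 1?ltnW// -wz; last first.
    by apply: leq_ltn_trans jN; rewrite leq_addr.
  by rewrite -wf iter_shiftE.
apply: (@le_trans _ _ ((#|words (R := R) A l|)%:R * (2 * expR (- N%:R)) `^ s)%:E).
  rewrite lee_fin; apply: (@le_trans _ _
      (expR (t * l%:R) * (2 * expR (- N%:R)) `^ s)); last first.
    by rewrite ler_wpM2r ?powR_ge0//; exact: (expR_le_nwords x0A).
  apply: le_trans (packing_growth r s0 st (n_k k) kt); lra.
apply: (packing_content_ge (y_ := y_)) => //.
- by move=> u _; case: (yP u).
- move=> u v uW vW uv; rewrite -(fK u)// -(fK v)//; apply/wordP => j jl.
  have [_ <-//] := yP u; have [_ <-//] := yP v.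
  by apply: uv; apply: leq_ltn_trans (window_index jl); rewrite leq_addr.
- rewrite expRN invf_ple ?posrE ?expR_gt0//.
  apply: le_trans (expR_ge1Dx _); rewrite mul1r in kd.
  rewrite (le_trans kd)// (@le_trans _ _ N%:R) ?lerDr// ler_nat /N.
  by rewrite (leq_trans (n_k k))// leq_pmull.
Qed.

End packing_lower.

(** * Points with a prescribed weighted average and free windows *)

Section windows.
Context {R : realType}.
Implicit Types (s : R^nat) (C : R).

Lemma frequently_light s C N : (forall n, 0 < s n) ->
  limn_esup (fun n => (series s n / (n%:R * s n))%:E) = +oo%E ->
  exists2 n, (N <= n)%N & C * (n%:R * s n) <= series s n.
Proof.
move=> s0 limsup; apply: contrapT => nolight.
suff : (limn_esup (fun n => (series s n / (n%:R * s n))%:E) <= C%:E)%E.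
  by rewrite limsup.
apply: limn_esup_le_near; apply: filterS2 (nbhs_infty_ge N) (nbhs_infty_gt 0).
move=> n Nn n0; rewrite lee_fin ler_pdivrMr ?mulr_gt0 ?ltr0n//.
by rewrite leNgt; apply/negP => /ltW ?; apply: nolight; exists n.
Qed.

(** The time [n] is so late that the weight before [a] is negligible with respect
    to the weight before [n], and so is the weight of the window from [n] to
    [k.+2 * n], which is at most the third left-hand side divided by [k.+1].
    The factor [k.+2] tends to infinity, and it is at least [2] in order to leave
    room for the transitions. *)
Definition light_window s r k a n :=
  [/\ (k + a + r < n)%N, k.+1%:R * series s a <= series s n &
      k.+1%:R * (k.+2 * n)%:R * s n <= series s n].

Lemma light_window_exists s r k a : (forall n, 0 < s n) ->
  series s @ \oo --> +oo ->
  limn_esup (fun n => (series s n / (n%:R * s n))%:E) = +oo%E ->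
  exists n, light_window s r k a n.
Proof.
move=> s0 Sy limsup.
have := cvgy_absorb (k.+1%:R * series s a) Sy ltr01 => -[N _ NS].
have [n] := frequently_light (k.+1%:R * k.+2%:R) (maxn N (k + a + r).+1) s0 limsup.
rewrite geq_max => /andP[Nn n_gt] nS; exists n; split=> //.
  by have := NS n Nn; rewrite mul1r.
by rewrite natrM mulrA -[_ * _ * s n]mulrA.
Qed.

(** The next window is chosen after the end [a_ k] of the previous one. *)
Lemma light_windows s r : (forall n, 0 < s n) -> series s @ \oo --> +oo ->
  limn_esup (fun n => (series s n / (n%:R * s n))%:E) = +oo%E ->
  exists a_ n_ : nat -> nat, [/\ a_ 0%N = 0%N,
    forall k, a_ k.+1 = (k.+2 * n_ k)%N &
    forall k, light_window s r k (a_ k) (n_ k)].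
Proof.
move=> s0 Sy limsup.
have /choice[nn nnP] (ka : nat * nat) : exists n, light_window s r ka.1 ka.2 n.
  exact: light_window_exists.
pose a_ := fix a_ k := if k is k'.+1 then (k'.+2 * nn (k', a_ k'))%N else 0%N.
exists a_, (fun k => nn (k, a_ k)); split=> // k.
exact: (nnP (k, a_ k)).
Qed.

Lemma sum_initial s a n : (a <= n)%N ->
  \sum_(0 <= j < n) s j * (j < a)%:R = series s a.
Proof.
move=> an; rewrite (@big_cat_nat _ _ _ a)//= [X in _ + X]big1_seq ?addr0.
  rewrite /series/= big_nat [RHS]big_nat; apply: eq_bigr => j /andP[_ ->].
  by rewrite mulr1.
move=> j; rewrite mem_index_iota => /andP[_ /andP[aj _]].
by rewrite ltnNge aj mulr0.
Qed.

(** Modifying a point on light windows does not change its weighted averages.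
    Apart from [m] steps before each window, the orbits of [x] and [y] are close
    to each other outside the windows, and for a time [n] between the starts of the
    [k]-th and the [k.+1]-st windows everything before [a_ k] is negligible. *)
Lemma window_weighted_average K (A : 'M[nat]_K) s r (a_ n_ : nat -> nat)
    (phi : fullshift R K -> R) alpha x y :
  nonincreasing_seq s -> (forall n, 0 < s n) -> series s @ \oo --> +oo ->
  (forall k, a_ k.+1 = (k.+2 * n_ k)%N) ->
  (forall k, light_window s r k (a_ k) (n_ k)) ->
  {within sft R A, continuous phi} -> sft R A y ->
  (forall k j, (a_ k <= j)%N -> (j < n_ k)%N -> y j = x j) ->
  weighted_level_set A s phi alpha x -> weighted_level_set A s phi alpha y.
Proof.
move=> s_dec s0 Sy aS win phi_c yA yx [xA cvx]; split=> //.
have s_ge0 k : 0 <= s k by exact: ltW.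
apply/average_cvgP => [|e e0]; first exact: series_gt0.
have e40 : 0 < e / 4 by rewrite divr_gt0.
have [m [C mC]] := continuous_uniform phi_c e40.
have C0 : 0 <= C by have [/(le_trans (normr_ge0 _))] := mC y y yA yA.
have /average_cvgP /(_ _ e40) cvx' := cvx; have {cvx'} cvx' := cvx' (series_gt0 s0).
have an k : (a_ k < n_ k)%N by have [] := win k; lia.
have na k : (n_ k < a_ k.+1)%N by rewrite aS; have := an k; nia.
have nS k : (n_ k < n_ k.+1)%N by exact: ltn_trans (na k) (an k.+1).
have Ny : (fun n => n%:R : R) @ \oo --> +oo by exact: cvgr_idn.
have [k0 _ k0P] := cvgy_absorb (4 * C) Ny e40.
have := cvgy_absorb (4 * C * m%:R * s 0%N) Sy e40.
apply: filterS2 (filterI cvx' (nbhs_infty_ge (n_ k0))) => n [xn k0n] Sbig.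
pose b_ k := if k is k'.+1 then n_ k' else 0%N.
have [//|[|k]/=|k /andP[]] := @exists_block b_ _ _ n.
- by exact: leq_ltn_trans (an 0%N).
- exact: nS.
case: k => [_|k /= kn nk].
  rewrite /= ltnNge => /negP[]; apply: leq_trans k0n.
  by apply: (homo_leq (@leqnn) leq_trans) => // i; exact: ltnW.
have k0k : (k0 <= k)%N.
  rewrite leqNgt; apply/negP => kk0.
  have : (n_ k.+1 <= n_ k0)%N.
    by apply: (homo_leq (@leqnn) leq_trans) => // i; exact: ltnW.
  by move=> /leq_trans/(_ k0n); rewrite leqNgt nk.
have kbig := k0P k k0k.
have [_ Sa Sw] := win k.
set S := series s n in xn Sbig *.
have Snk : series s (n_ k) <= S.
  rewrite /S /series /= (@big_cat_nat _ _ _ (n_ k) 0 n)//= lerDl.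
  by apply: sumr_ge0.
pose dist j := `|phi (iter j left_shift y) - phi (iter j left_shift x)|.
pose w (i l j : nat) : R := (i <= j < l)%:R.
(* Where the orbits need not be close, one of the four indicators is [1]. *)
have distP j : (j < n)%N -> dist j <= e / 4 + 2 * C * ((j < a_ k)%:R +
    (w (n_ k - m)%N (n_ k) j + w (n_ k) (a_ k.+1) j +
     w (n_ k.+1 - m)%N (n_ k.+1) j)).
  move=> jn; have yj := sft_iter_shift j yA; have xj := sft_iter_shift j xA.
  have w0 i l : 0 <= w i l j by rewrite ler0n.
  have [good|] := boolP [|| (a_ k <= j) && (j + m <= n_ k) |
      (a_ k.+1 <= j) && (j + m <= n_ k.+1)]%N.
    apply: (@le_trans _ _ (e / 4)); last first.
      by rewrite lerDl !(mulr_ge0, addr_ge0).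
    have [_] := mC _ _ yj xj; apply => l lm; rewrite !iter_shiftE.
    by case/orP: good => /andP[aj jn']; apply: yx (leq_trans aj (leq_addr _ _)) _;
      apply: leq_trans jn'; rewrite ltn_add2l.
  move=> bad; have d2C : dist j <= 2 * C.
    rewrite /dist (le_trans (ler_normB _ _))//.
    by have [] := mC _ _ yj yj; have [] := mC _ _ xj xj; lra.
  apply: (le_trans d2C); apply: ler_wpDl; first exact: ltW.
  rewrite -[leLHS]mulr1 ler_wpM2l ?mulr_ge0// /w -!natrD ler1n.
  have := na k; have := an k; have := an k.+1; move: bad jn nk {w0}; clear; lia.
have distS : \sum_(0 <= j < n) s j * dist j <=
    e / 4 * S + 2 * C * (series s (a_ k) + (m%:R * s 0%N +
      (a_ k.+1)%:R * s (n_ k) + m%:R * s 0%N)).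
  apply: (@le_trans _ _ (\sum_(0 <= j < n) s j * (e / 4 + 2 * C * ((j < a_ k)%:R +
    (w (n_ k - m)%N (n_ k) j + w (n_ k) (a_ k.+1) j +
     w (n_ k.+1 - m)%N (n_ k.+1) j))))).
    rewrite big_nat [leRHS]big_nat; apply: ler_sum => j /andP[_ jn].
    by rewrite ler_wpM2l// distP.
  under eq_bigr do rewrite mulrDr (mulrC _ (e / 4)) (mulrCA _ (2 * C)).
  rewrite big_split/= -mulr_sumr lerD2l -mulr_sumr ler_wpM2l ?mulr_ge0//.
  under eq_bigr do rewrite !mulrDr.
  rewrite !big_split/= sum_initial; last by rewrite (leq_trans _ kn)// ltnW.
  have edge i : \sum_(0 <= j < n) s j * w (i - m)%N i j <= m%:R * s 0%N.
    apply: (le_trans (sum_window _ _ _ s_dec s_ge0)).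
    by rewrite ler_pM//; [by rewrite ler_nat leq_subLR addnC -leq_subLR|exact: s_dec].
  rewrite lerD2l lerD ?edge// lerD ?edge//.
  apply: (le_trans (sum_window _ _ _ s_dec s_ge0)).
  by rewrite ler_wpM2r// ler_nat leq_subr.
have SC : 2 * C * (series s (a_ k) + (a_ k.+1)%:R * s (n_ k)) <= e / 4 * S.
  have Sn0 : 0 <= series s (n_ k) by apply: sumr_ge0.
  have h : k.+1%:R * (series s (a_ k) + (a_ k.+1)%:R * s (n_ k)) <=
      2 * series s (n_ k) by rewrite aS; lra.
  have k1 : 0 < k.+1%:R :> R by rewrite ltr0n.
  rewrite -(ler_pM2l k1) mulrCA; apply: (@le_trans _ _ (2 * C * (2 * S))).
    by rewrite ler_wpM2l ?mulr_ge0// (le_trans h)// ler_wpM2l.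
  have S0 : 0 <= S by exact: le_trans Snk.
  have : 4 * C * S <= e / 4 * k%:R * S by rewrite ler_wpM2r.
  have : 0 <= e / 4 * S by rewrite mulr_ge0// ltW.
  by rewrite -[k.+1%:R]natr1; lra.
have -> : \sum_(0 <= j < n) s j * phi (iter j left_shift y) - alpha * S =
    \sum_(0 <= j < n) s j * (phi (iter j left_shift y) - phi (iter j left_shift x))
    + (\sum_(0 <= j < n) s j * phi (iter j left_shift x) - alpha * S).
  by under [X in _ = X + _]eq_bigr do rewrite mulrBr; rewrite sumrB addrA subrK.
apply: (le_trans (ler_normD _ _)).
have : `|\sum_(0 <= j < n) s j * (phi (iter j left_shift y) -
    phi (iter j left_shift x))| <= \sum_(0 <= j < n) s j * dist j.
  apply: le_trans (ler_norm_sum _ _ _) _; apply: ler_sum => j _.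
  by rewrite normrM ger0_norm.
by move: distS xn SC Sbig; clearbody dist; lra.
Qed.

(** In the block from [a_ k] to [a_ k.+1] the orbits of [x] and then of [z] are
    followed at their own times; the transitions, one in the middle and one at the
    end of the block, both take place inside the window. *)
Lemma insert_windows K (A : 'M[nat]_K) s r (a_ n_ : nat -> nat) x z :
  gluing_time (R := R) A r -> a_ 0%N = 0%N ->
  (forall k, a_ k.+1 = (k.+2 * n_ k)%N) ->
  (forall k, light_window s r k (a_ k) (n_ k)) ->
  sft R A x -> sft R A z -> exists y, [/\ sft R A y,
    (forall k j, (a_ k <= j)%N -> (j < n_ k)%N -> y j = x j) &
    (forall k j, (n_ k + r <= j)%N -> (j + r <= k.+2 * n_ k)%N -> y j = z j)].
Proof.
move=> gl a0 aS win xA zA.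
have an k : (a_ k + r < n_ k)%N by have [] := win k; lia.
have n2 k : (n_ k + n_ k <= k.+2 * n_ k)%N by rewrite !mulSn; lia.
have /choice[w_ w_P] k : exists w : fullshift R K, [/\ sft R A w,
    (forall j, (j < n_ k - a_ k)%N -> w j = x (a_ k + j)%N) &
    (forall j, w (n_ k - a_ k + r + j)%N = z (n_ k + r + j)%N)].
  have [w wA [xw wz]] := gl.2 _ _ (n_ k - a_ k)%N (sft_iter_shift (a_ k) xA)
    (sft_iter_shift (n_ k + r) zA).
  exists w; split=> // j; first by move=> jn; rewrite -xw ?iter_shiftE// ltnW.
  by rewrite -iter_shiftE wz iter_shiftE.
have [k|k|y yA yw] := specification gl (x_ := w_) _ a0.
- by have [] := w_P k.
- by rewrite aS; have := an k; have := n2 k; lia.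
exists y; split=> // k j aj jn.
  have [_ wx _] := w_P k; rewrite -(subnKC aj) yw; first by rewrite wx//; lia.
  by rewrite aS; have := an k; have := n2 k; lia.
have [_ _ wz] := w_P k; have ank := an k.
have -> : j = (a_ k + (n_ k - a_ k + r + (j - (n_ k + r))))%N by lia.
rewrite yw ?wz; last by rewrite aS; lia.
by congr z; lia.
Qed.

End windows.

(** * The packing dimension of the level sets *)

Theorem theorem1p4 (R : realType) (K : nat) (A : 'M[nat]_K)
    (A01 : forall a b, A a b = 0%N \/ A a b = 1%N)
    (Aprim : aperiodic_irreducible A)
    (s : R^nat)
    (s_dec : nonincreasing_seq s)
    (s_gt0 : forall n, 0 < s n)
    (S_cvgy : series s @ \oo --> +oo)
    (S_limsup : limn_esup (fun n => (series s n / (n%:R * s n))%:E) = +oo%E)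
    (phi : fullshift R K -> R)
    (phi_cont : {within sft R A, continuous phi}) :
  (forall alpha : R, ~ birkhoff_spectrum A phi alpha ->
     weighted_level_set A s phi alpha = set0) /\
  (forall alpha : R, birkhoff_spectrum A phi alpha ->
     packing_dim (weighted_level_set A s phi alpha) =
     top_entropy (@left_shift R K) (sft R A)).
Proof.
have [r gl] := primitive_gluing (R := R) A01 Aprim.
split=> [alpha nalpha|alpha [x xA x_cvg]].
  apply/seteqP; split=> // x xalpha; case: nalpha.
  exact: weighted_level_set_spectrum gl phi_cont s_dec s_gt0 S_cvgy xalpha.
have xE : weighted_level_set A s phi alpha x.
  by split=> //; exact: weighted_average_cvg.
set E := weighted_level_set A s phi alpha in xE *.
set h := top_entropy _ _.
have h0 : (0 <= h)%E by exact: top_entropy_ge0 xA.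
apply/eqP; rewrite eq_le; apply/andP; split.
  apply/lee_addgt0Pr => e e0.
  case: h h0 (@nwords_lt_expR R K A x xA : forall t, (h < t%:E)%E -> _)
    => [h| |]//= h0 nwords_lt; last by rewrite leey.
  rewrite lee_fin in h0.
  apply: ereal_inf_lbound; exists (h + e) => //; split.
    by rewrite addr_ge0// ltW.
  apply: (@packing_measure_eq0 R K A E (h + e / 2)).
  - by rewrite addr_ge0// ltW.
  - by rewrite ltrD2l ltr_pdivrMr// ltr_pMr// ltr1n.
  - by move=> y [].
  - have := nwords_lt (h + e / 2); rewrite lte_fin ltrDl divr_gt0// => /(_ isT).
    by apply: filterS => n /ltW.
apply: le_ereal_inf_tmp => _ [t [t0 Et] <-]; rewrite leNgt; apply/negP => th.
have [t' tt' t'h] : exists2 t', t < t' & (t'%:E < h)%E.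
  case: h th {h0} => [h| |]//; rewrite ?lte_fin => th.
    by exists ((t + h) / 2); rewrite ?lte_fin; lra.
  by exists (t + 1); rewrite ?ltry// ltrDl.
have [a_ [n_ [a0 aS win]]] := light_windows r s_gt0 S_cvgy S_limsup.
have /choice[Phi PhiP] (z : fullshift R K) : exists y, sft R A z ->
    [/\ sft R A y, (forall k j, (a_ k <= j)%N -> (j < n_ k)%N -> y j = x j) &
    (forall k j, (n_ k + r <= j)%N -> (j + r <= k.+2 * n_ k)%N -> y j = z j)].
  have [zA|] := pselect (sft R A z); last by exists z.
  by have [y yP] := insert_windows gl a0 aS win xA zA; exists y.
have PhiE : Phi @` sft R A `<=` E.
  move=> _ [z /PhiP[yA yx _] <-].
  exact: window_weighted_average s_dec s_gt0 S_cvgy aS win phi_cont yA yx xE.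
have /ereal_inf_lt[_ [F EF <-] sumF] : (packing_measure t E < 1)%E.
  by rewrite Et lte01.
have [|z zA||i Fi] := packing_premeasure_window (n_ := n_) (Phi := Phi) (F := F)
  gl xA t0 tt' t'h.
- by move=> k; have [] := win k; lia.
- by have [] := PhiP z zA.
- by apply: subset_trans EF.
have F0 k : (0 <= packing_premeasure t (F k))%E.
  by apply: le_ereal_inf_tmp => _ [d _ <-]; exact: packing_content_ge0.
move: sumF; rewrite (@nneseriesD1 R _ i xpredT)// Fi addye//.
by rewrite gt_eqF// (lt_le_trans (ltNyr 0))// nneseries_ge0.
Qed.
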